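(* Let $(X,r)$ be a solution. Then $G_{(X,r)}$ is bi-orderable if and only if it is free abelian. In this case, (1) the orbits of the solution $(X,r)$ and of its structure rack $(X,\triangleleft_r)$ coincide, and $k_r=K_r$; (2) the group morphism $\nu\colon G_{(X,r)}\twoheadrightarrow\mathbb{Z}^{k_r}$ sending every $x\in X$ from the orbit $\mathcal{O}_i$ of $(X,r)$ to the generator $e_i$ of $\mathbb{Z}^{k_r}$ is an isomorphism, where $\mathcal{O}_1,\ldots,\mathcal{O}_{k_r}$ are the orbits of $(X,r)$ and $e_1,\ldots,e_{k_r}$ is the standard basis of $\mathbb{Z}^{k_r}$.
   Context: A solution $(X,r)$ is a finite set $X$ with a bijection $r\colon X\times X\to X\times X$, $r(x,y)=(\sigma_x(y),\tau_y(x))$, satisfying the Yang--Baxter equation $r_1r_2r_1=r_2r_1r_2$ on $X^3$ ($r_1=r\times \mathrm{Id}_X$, $r_2=\mathrm{Id}_X\times r$), with all maps $\sigma_x,\tau_x\colon X\to X$ bijective. Its structure group is $G_{(X,r)}=\langle X \mid xy=\sigma_x(y)\tau_y(x),\ x,y\in X\rangle$. The orbits of $(X,r)$ are the orbits of $X$ under all permutations $\sigma_z,\tau_z$, $z\in X$; their number is $k_r$. The structure rack is $(X,\triangleleft_r)$ with $x\triangleleft_r y=\tau_y\sigma_{\tau_x^{-1}(y)}(x)$; its orbits are the orbits of $X$ under the permutations $x\mapsto x\triangleleft_r y$, $y\in X$; their number is $K_r$. A group is bi-orderable if it admits a total order stable under both left and right translations. *)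

(* Defs.v *)
From HB Require Import structures.
From mathcomp Require Import freeg.
From mathcomp Require Import all_boot all_order all_algebra all_fingroup.
From mathcomp Require Import boolp.
From mathcomp Require Import generic_quotient.

Set Implicit Arguments.
Unset Strict Implicit.
Unset Printing Implicit Defensive.

Section Presentation.
Local Open Scope quotient_scope.

Variable X : choiceType.

(* The letter (x, false) stands for x and (x, true) for x^-1. *)
Definition word := seq (X * bool).

Variable R : word -> word -> Prop.

Inductive pres_eq : word -> word -> Prop :=
| pres_eq_refl u : pres_eq u u
| pres_eq_sym u v : pres_eq u v -> pres_eq v u
| pres_eq_trans v u w : pres_eq u v -> pres_eq v w -> pres_eq u w
| pres_eq_cat u u' v v' :
    pres_eq u u' -> pres_eq v v' -> pres_eq (u ++ v) (u' ++ v')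
| pres_eq_cancel x b : pres_eq [:: (x, b); (x, ~~ b)] [::]
| pres_eq_rel u v : R u v -> pres_eq u v.

Definition pres_eqb (u v : word) : bool := `[< pres_eq u v >].

Fact pres_eqb_refl : reflexive pres_eqb.
Proof. by move=> u; apply/asboolP/pres_eq_refl. Qed.

Fact pres_eqb_sym : symmetric pres_eqb.
Proof. by move=> u v; apply/asboolP/asboolP => /pres_eq_sym. Qed.

Fact pres_eqb_trans : transitive pres_eqb.
Proof.
by move=> v u w /asboolP uv /asboolP vw; apply/asboolP/(pres_eq_trans uv vw).
Qed.

Canonical pres_equiv :=
  EquivRel pres_eqb pres_eqb_refl pres_eqb_sym pres_eqb_trans.

Definition pres_group := {eq_quot pres_eqb}.

HB.instance Definition _ := Choice.on pres_group.
HB.instance Definition _ := EqQuotient.on pres_group.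

Definition word_inv (u : word) : word := rev [seq (l.1, ~~ l.2) | l <- u].

Definition pres_one : pres_group := \pi_pres_group [::].
Definition pres_mul (a b : pres_group) : pres_group :=
  \pi_pres_group (repr a ++ repr b).
Definition pres_inv (a : pres_group) : pres_group :=
  \pi_pres_group (word_inv (repr a)).

Lemma pres_piP (u v : word) :
  reflect (pres_eq u v) (\pi_pres_group u == \pi_pres_group v).
Proof. by rewrite eqmodE; exact: asboolP. Qed.

Lemma pres_repr_pi (u : word) : pres_eq (repr (\pi_pres_group u)) u.
Proof. by apply/pres_piP; rewrite reprK. Qed.

Lemma word_invK : involutive word_inv.
Proof.
move=> u; rewrite /word_inv map_rev revK -map_comp.
by rewrite (eq_map (g := id)) ?map_id // => -[x b] /=; rewrite negbK.
Qed.

Lemma pres_eq_mulV u : pres_eq (u ++ word_inv u) [::].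
Proof.
elim: u => [|[x b] u IHu]; first exact: pres_eq_refl.
have -> : word_inv ((x, b) :: u) = word_inv u ++ [:: (x, ~~ b)].
  by rewrite /word_inv /= rev_cons cats1.
have -> : ((x, b) :: u) ++ word_inv u ++ [:: (x, ~~ b)] =
    [:: (x, b)] ++ (u ++ word_inv u) ++ [:: (x, ~~ b)] by rewrite -catA.
apply: pres_eq_trans (pres_eq_cancel x b).
rewrite -[[:: (x, b); _]]/([:: (x, b)] ++ [::] ++ [:: (x, ~~ b)]).
apply: pres_eq_cat; first exact: pres_eq_refl.
by apply: pres_eq_cat => //; exact: pres_eq_refl.
Qed.

Lemma pres_eq_Vmul u : pres_eq (word_inv u ++ u) [::].
Proof. by have := pres_eq_mulV (word_inv u); rewrite word_invK. Qed.

Fact pres_mulA : associative pres_mul.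
Proof.
move=> a b c; apply/eqP/pres_piP.
apply: (@pres_eq_trans (repr a ++ repr b ++ repr c)).
  by apply: pres_eq_cat; [exact: pres_eq_refl | exact: pres_repr_pi].
rewrite catA; apply/pres_eq_sym/pres_eq_cat; last exact: pres_eq_refl.
exact: pres_repr_pi.
Qed.

Fact pres_mul1g : left_id pres_one pres_mul.
Proof.
move=> a; rewrite -[RHS]reprK; apply/eqP/pres_piP.
rewrite -[X in pres_eq _ X]cat0s; apply: pres_eq_cat.
  exact: pres_repr_pi.
exact: pres_eq_refl.
Qed.

Fact pres_mulg1 : right_id pres_one pres_mul.
Proof.
move=> a; rewrite -[RHS]reprK; apply/eqP/pres_piP.
rewrite -[X in pres_eq _ X]cats0; apply: pres_eq_cat.
  exact: pres_eq_refl.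
exact: pres_repr_pi.
Qed.

Fact pres_mulVg : left_inverse pres_one pres_inv pres_mul.
Proof.
move=> a; apply/eqP/pres_piP; apply: pres_eq_trans (pres_eq_Vmul (repr a)).
by apply: pres_eq_cat; [exact: pres_repr_pi | exact: pres_eq_refl].
Qed.

Fact pres_mulgV : right_inverse pres_one pres_inv pres_mul.
Proof.
move=> a; apply/eqP/pres_piP; apply: pres_eq_trans (pres_eq_mulV (repr a)).
by apply: pres_eq_cat; [exact: pres_eq_refl | exact: pres_repr_pi].
Qed.

HB.instance Definition _ :=
  isGroup.Build pres_group pres_mulA pres_mul1g pres_mulg1
    pres_mulVg pres_mulgV.

Definition pres_gen (x : X) : pres_group := \pi_pres_group [:: (x, false)].

Section Eval.
Local Open Scope group_scope.
Variables (H : groupType) (f : X -> H).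

Definition word_eval (u : word) : H :=
  \prod_(l <- u) (if l.2 then (f l.1)^-1 else f l.1).

Hypothesis fR : forall u v, R u v -> word_eval u = word_eval v.

Lemma pres_eq_eval u v : pres_eq u v -> word_eval u = word_eval v.
Proof.
elim=> {u v} [u||v u w _ -> _ ->|u u' v v' _ eu _ ev|x b|] //.
  by rewrite /word_eval !big_cat /= -!/(word_eval _) eu ev.
rewrite /word_eval big_cons big_seq1 big_nil /=.
by case: b; rewrite /= ?mulVg ?mulgV.
Qed.

Definition pres_lift (a : pres_group) : H := word_eval (repr a).

Fact pres_liftM : {morph pres_lift : a b / a * b}.
Proof.
move=> a b; rewrite /pres_lift (pres_eq_eval (pres_repr_pi _)).
exact: big_cat.
Qed.

Fact pres_lift1 : pres_lift 1 = 1.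
Proof. by rewrite /pres_lift (pres_eq_eval (pres_repr_pi _)); exact: big_nil. Qed.

Lemma pres_lift_gen x : pres_lift (pres_gen x) = f x.
Proof.
by rewrite /pres_lift (pres_eq_eval (pres_repr_pi _)) /word_eval big_seq1.
Qed.

End Eval.

Lemma pres_morph_eq (H : groupType) (f g : pres_group -> H) :
    {morph f : a b / (a * b)%g} -> {morph g : a b / (a * b)%g} ->
  (forall x, f (pres_gen x) = g (pres_gen x)) -> f =1 g.
Proof.
move=> fM gM fg.
have morph1 (h : pres_group -> H) : {morph h : a b / (a * b)%g} -> h 1%g = 1%g.
  by move=> hM; apply: (@mulgI _ (h 1%g)); rewrite -hM !mulg1.
have morphV (h : pres_group -> H) : {morph h : a b / (a * b)%g} ->
    forall a, h (a^-1)%g = ((h a)^-1)%g.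
  by move=> hM a; apply: (@mulgI _ (h a)); rewrite -hM !mulgV morph1.
have piM u v : \pi_pres_group (u ++ v) =
    (\pi_pres_group u * \pi_pres_group v)%g.
  apply/eqP/pres_piP/pres_eq_sym.
  by apply: pres_eq_cat; exact: pres_repr_pi.
move=> a; rewrite -[a]reprK; elim: (repr a) => [|[x b] u IHu].
  by rewrite -[\pi [::]]/(1%g : pres_group) !morph1.
rewrite -cat1s piM fM gM {}IHu; congr (_ * _)%g.
case: b; last exact: fg.
have -> : \pi_pres_group [:: (x, true)] = ((pres_gen x)^-1)%g.
  apply: (@mulgI _ (pres_gen x)); rewrite mulgV -piM.
  exact/eqP/pres_piP/(pres_eq_cancel x false).
by rewrite !morphV // fg.
Qed.

End Presentation.

Section YangBaxter.
Variable X : Type.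
Variable r : X * X -> X * X.

Definition yb_r1 (t : X * X * X) : X * X * X := (r t.1, t.2).
Definition yb_r2 (t : X * X * X) : X * X * X :=
  let p := r (t.1.2, t.2) in (t.1.1, p.1, p.2).

Definition yang_baxter : Prop :=
  yb_r1 \o yb_r2 \o yb_r1 =1 yb_r2 \o yb_r1 \o yb_r2.

End YangBaxter.

Definition yb_map (X : finType) (sg ta : X -> {perm X}) (p : X * X) : X * X :=
  (sg p.1 p.2, ta p.2 p.1).

Record solution (X : finType) := Solution {
  sigma : X -> {perm X};
  tau : X -> {perm X};
  sol_bij : bijective (yb_map sigma tau);
  sol_yb : yang_baxter (yb_map sigma tau) }.

Section StructureGroup.
Variables (X : finType) (s : solution X).

Definition structure_rel (u v : word X) : Prop :=
  exists x y : X, u = [:: (x, false); (y, false)] /\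
    v = [:: (sigma s x y, false); (tau s y x, false)].

Definition structure_group := pres_group structure_rel.

HB.instance Definition _ := Group.on structure_group.

Definition structure_gen (x : X) : structure_group :=
  pres_gen structure_rel x.

Fact structure_gen_rel (x y : X) :
  (structure_gen x * structure_gen y =
     structure_gen (sigma s x y) * structure_gen (tau s y x))%g.
Proof.
have genM (a b : X) :
    (pres_gen structure_rel a * pres_gen structure_rel b)%g =
    \pi_(pres_group structure_rel)%qT [:: (a, false); (b, false)].
  apply/eqP/pres_piP.
  by apply: (pres_eq_cat (u' := [:: _]) (v' := [:: _])); exact: pres_repr_pi.
rewrite [LHS]genM [RHS]genM.
by apply/eqP/pres_piP/pres_eq_rel; exists x, y.
Qed.

End StructureGroup.

Definition perm_orbits (X : finType) (A : {set {perm X}}) : {set {set X}} :=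
  [set orbit 'P <<A>>%g x | x : X].

Section Orbits.
Variables (X : finType) (s : solution X).

Definition sol_orbits : {set {set X}} :=
  perm_orbits ([set sigma s z | z : X] :|: [set tau s z | z : X]).

Definition num_sol_orbits : nat := #|sol_orbits|.

Definition rack_op (x y : X) : X :=
  tau s y (sigma s (((tau s x)^-1)%g y) x).

Fact rack_op_inj (y : X) : injective (rack_op^~ y).
Proof.
move=> x x' /perm_inj e.
have /(bij_inj (sol_bij s)) [] // :
    yb_map (sigma s) (tau s) (((tau s x)^-1)%g y, x) =
    yb_map (sigma s) (tau s) (((tau s x')^-1)%g y, x').
by rewrite /yb_map /= e !permKV.
Qed.

Definition rack_perm (y : X) : {perm X} := perm (@rack_op_inj y).

Definition rack_orbits : {set {set X}} :=
  perm_orbits [set rack_perm y | y : X].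

Definition num_rack_orbits : nat := #|rack_orbits|.

End Orbits.

Definition bi_orderable (G : groupType) : Prop :=
  exists le : rel G,
    [/\ reflexive le, antisymmetric le, transitive le & total le] /\
    (forall a b c : G, le a b -> le (c * a)%g (c * b)%g /\ le (a * c)%g (b * c)%g).

(* to_multiplicative turns an additive group into a multiplicative one, and
   {freeg I / int} is the free abelian group on I, of any cardinality. *)
Definition free_abelian (G : groupType) : Prop :=
  exists (I : choiceType)
    (f : {multiplicative G -> Algebra.to_multiplicative {freeg I / int}}), bijective f.

(* Main.v *)
Require Import Defs.
From HB Require Import structures.
From mathcomp Require Import all_boot all_order all_algebra all_fingroup.
From mathcomp Require Import freeg.

(** The structure group G is virtually abelian in a very concrete way.  A
    positive word u moves past a letter y by u y = sigma_u(y) tau_y(u), where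
    tau_y(u) has the same length as u; if sigma_u is the identity, then so is
    the sigma-action of tau_y(u), and the formula says that conjugation by y
    permutes the finitely many words of a given length acting trivially.
    Hence every element of that kind has finitely many conjugates under the
    powers of y.  In a bi-orderable group nth roots are unique, and there an
    element with finitely many such conjugates already commutes with y.
    Applied to u = x^n with n the order of sigma_x, this makes x^n, and
    therefore x, commute with y: G is abelian.

    Next, x y^m = (prod_(i < m) sigma_(tau_y^i x)(y)) tau_y^m(x), so for m the
    order of tau_y commutativity gives y^m = prod_(i < m) sigma_(tau_y^i x)(y).
    If y is order-maximal in its orbit under the sigma's, no factor exceeds
    y, so every factor equals y: this maximum principle shows that generators
    are constant on orbits of the solution (gen_sigma, gen_tau,
    gen_sol_orbit).  So G is an abelian group generated by one element per
    orbit, and the map nu to Z^k has an inverse (orbit_coordinates).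

    The rack orbits are contained in the orbits of the solution.  Conversely,
    G always separates generators lying in different rack orbits
    (gen_eq_rack_orbit): the assignment of its rack orbit to a generator
    extends to a 1-cocycle of G; reduced modulo 2, it is encoded as an action of
    G on the boolean functions on X in which x acts by tau_x followed by adding
    the indicator of the rack orbit of x.  As generators are constant on
    orbits of the solution, the two kinds of orbits coincide.

    Finally, in a free abelian structure group only finitely many basis
    elements occur in the images of the finitely many generators, and comparing
    the corresponding coordinates lexicographically is a bi-order. *)

Set Implicit Arguments.
Unset Strict Implicit.
Unset Printing Implicit Defensive.
Import Order.TTheory GRing.Theory Num.Theory.

(** * Bi-ordered groups and unique roots *)

Section BiOrderedGroup.
Local Open Scope group_scope.
Variables (G : groupType) (le : rel G).
Hypotheses (le_refl : reflexive le) (le_anti : antisymmetric le).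
Hypotheses (le_trans : transitive le) (le_total : total le).
Hypothesis le_mul :
  forall a b c : G, le a b -> le (c * a) (c * b) /\ le (a * c) (b * c).

Lemma le_mulg2 a b c d : le a b -> le c d -> le (a * c) (b * d).
Proof.
move=> /(le_mul c)[_ le1] /(le_mul b)[le2 _].
exact: le_trans le1 le2.
Qed.

Lemma le_expg a b n : le a b -> le (a ^+ n) (b ^+ n).
Proof.
move=> ab; elim: n => [|n IHn]; first by rewrite !expg0.
by rewrite !expgS le_mulg2.
Qed.

Lemma expg_root_inj n : 0 < n -> injective (fun a : G => a ^+ n).
Proof.
case: n => // n _ a b /=; wlog ab : a b / le a b => [wlog_ab|] e.
  by case/orP: (le_total a b) => /wlog_ab; [exact | move/(_ (esym e))].
apply: (mulgI (b ^+ n)); apply: le_anti; apply/andP; split.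
  exact: (le_mul _ ab).1.
by rewrite -expgSr -e expgSr; apply: (le_mul _ (le_expg n ab)).2.
Qed.

Lemma le_prodg_expg (I : Type) (r : seq I) (F : I -> G) y :
  (forall i, le (F i) y) -> le (\prod_(i <- r) F i) (y ^+ size r).
Proof.
move=> Fy; elim: r => [|i r IHr]; first by rewrite big_nil.
by rewrite big_cons expgS le_mulg2.
Qed.

(** The equality case of the product bound: a head factor smaller than y could
    not be compensated by the others. *)
Lemma prodg_eq_expg (I : Type) (i : I) (r : seq I) (F : I -> G) y :
    (forall j, le (F j) y) ->
  \prod_(j <- i :: r) F j = y ^+ (size r).+1 -> F i = y.
Proof.
move=> Fy; rewrite big_cons expgS => e.
apply: (mulIg (y ^+ size r)); apply: le_anti; apply/andP; split.
  exact: (le_mul _ (Fy i)).2.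
by rewrite -e; apply: (le_mul _ (le_prodg_expg r Fy)).1.
Qed.

Lemma max_over_finite (T : finType) (P : pred T) (F : T -> G) (t0 : T) :
  P t0 -> exists2 t, P t & forall u, P u -> le (F u) (F t).
Proof.
move=> Pt0; pose ge := [rel a b | le b a].
have [] := @extremumP G T ge t0 P F _ _ _ Pt0.
- exact: le_refl.
- by move=> a b c /= ba cb; apply: le_trans ba.
- by move=> a b; rewrite /= orbC le_total.
by move=> t Pt max_t; exists t => // u /max_t.
Qed.

End BiOrderedGroup.

Section UniqueRoots.
Local Open Scope group_scope.
Variable G : groupType.
Hypothesis expg_inj : forall n, 0 < n -> injective (fun a : G => a ^+ n).

(** If b commutes with a^n, then a conjugated by b is another nth root of
    a^n. *)
Lemma commute_of_expgl (a b : G) n : 0 < n -> commute (a ^+ n) b -> commute a b.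
Proof.
move=> n_gt0 /commgP/conjg_fixP; rewrite conjXg => /(expg_inj n_gt0) e.
exact/commgP/conjg_fixP.
Qed.

(** By pigeonhole a commutes with some positive power of b, hence with b by
    uniqueness of roots. *)
Lemma commute_of_finite_conj (T : finType) (F : T -> G) a b :
  (forall k, exists t, F t = a ^ (b ^+ k)) -> commute a b.
Proof.
move=> exF; have exFb k : exists t, F t == a ^ (b ^+ k).
  by have [t <-] := exF k; exists t.
pose t k := xchoose (exFb k).
have Ft k : F (t k) = a ^ (b ^+ k) by apply/eqP/(xchooseP (exFb k)).
have /injectivePn[i [j ne_ij tij]] : ~~ injectiveb (fun i : 'I_#|T|.+1 => t i).
  by apply/injectiveP => /leq_card; rewrite card_ord ltnn.
wlog lt_ij : i j ne_ij tij / i < j => [wlog_ij|].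
  case: (ltngtP i j) => [||/val_inj e]; first exact: wlog_ij.
    by apply: wlog_ij; rewrite // eq_sym.
  by rewrite e eqxx in ne_ij.
have /esym e : a ^ (b ^+ i) = (a ^ (b ^+ (j - i))) ^ (b ^+ i).
  by rewrite -conjgM -expgD subnK ?(ltnW lt_ij) // -!Ft tij.
have {e} /conjg_fixP/commgP/esym := conjg_inj _ e.
move/(commute_of_expgl (n := j - i)); rewrite subn_gt0 => /(_ lt_ij).
exact: esym.
Qed.

End UniqueRoots.

(** * The braiding on positive words *)

Lemma structure_morph_eq (X : finType) (s : solution X) (H : groupType)
    (f g : structure_group s -> H) :
    {morph f : a b / (a * b)%g} -> {morph g : a b / (a * b)%g} ->
  (forall x, f (structure_gen s x) = g (structure_gen s x)) -> f =1 g.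
Proof. exact: pres_morph_eq. Qed.

Lemma structure_lift (X : finType) (s : solution X) (H : groupType)
    (f : X -> H) :
    (forall x y, (f x * f y = f (sigma s x y) * f (tau s y x))%g) ->
  exists2 h : structure_group s -> H, {morph h : a b / (a * b)%g} &
    forall x, h (structure_gen s x) = f x.
Proof.
move=> f_rel.
have fR u v : structure_rel s u v -> word_eval f u = word_eval f v.
  by case=> x [y [-> ->]]; rewrite /word_eval !big_cons !big_nil !mulg1 f_rel.
exists (pres_lift f); first exact: pres_liftM fR.
exact: pres_lift_gen fR.
Qed.

Section Braiding.
Variables (X : finType) (s : solution X).
Local Notation sg := (sigma s).
Local Notation ta := (tau s).

Lemma yb_sigma x y z : sg x (sg y z) = sg (sg x y) (sg (ta y x) z).
Proof. by have [-> _ _] := sol_yb s (x, y, z). Qed.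

Lemma yb_mixed x y z :
  ta (sg (ta y x) z) (sg x y) = sg (ta (sg y z) x) (ta z y).
Proof. by have [_ -> _] := sol_yb s (x, y, z). Qed.

Lemma yb_tau x y z : ta z (ta y x) = ta (ta z y) (ta (sg y z) x).
Proof. by have [_ _ ->] := sol_yb s (x, y, z). Qed.

(** Extension of the braiding to pairs formed by a positive word u and a letter
    y: passing y to the left through u produces sigma_word u y on the left and
    tau_word y u on the right. *)
Definition sigma_word (u : seq X) (y : X) : X := foldr (fun x => sg x) y u.

Fixpoint tau_word (y : X) (u : seq X) : seq X :=
  if u is x :: u' then ta (sigma_word u' y) x :: tau_word y u' else [::].

Lemma size_tau_word y u : size (tau_word y u) = size u.
Proof. by elim: u => //= x u ->. Qed.

Lemma sigma_word_braid u y z :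
  sigma_word u (sg y z) =
  sg (sigma_word u y) (sigma_word (tau_word y u) z).
Proof. by elim: u => //= x u ->; rewrite yb_sigma. Qed.

Lemma sigma_word_nseq n x y : sigma_word (nseq n x) y = (sg x ^+ n)%g y.
Proof. by rewrite permX; elim: n => //= n ->. Qed.

Local Notation gen := (structure_gen s).
Local Open Scope group_scope.

Lemma gen_word_braid u y :
  (\prod_(x <- u) gen x) * gen y =
  gen (sigma_word u y) * \prod_(x <- tau_word y u) gen x.
Proof.
elim: u => [|x u IHu] /=; first by rewrite !big_nil mul1g mulg1.
by rewrite !big_cons -mulgA IHu !mulgA structure_gen_rel.
Qed.

Lemma gen_expg_braid x y m :
  gen x * gen y ^+ m =
  (\prod_(z <- traject (ta y) x m) gen (sg z y)) * gen ((ta y ^+ m) x).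
Proof.
elim: m x => [|m IHm] x; first by rewrite expg0 big_nil mul1g mulg1 perm1.
rewrite expgS mulgA structure_gen_rel -mulgA IHm big_cons mulgA.
by rewrite expgS permM.
Qed.

(** Conjugation by a generator only rewrites a word that acts trivially through
    sigma into another such word, by sigma_word_braid; there are finitely many
    words of the given length. *)
Lemma gen_word_finite_conj u y k : sigma_word u =1 id ->
  exists t : (size u).-tuple X,
    \prod_(x <- t) gen x = (\prod_(x <- u) gen x) ^ (gen y ^+ k).
Proof.
move=> u1; suff [v [sz_v _ ev]] : exists v,
    [/\ size v = size u, sigma_word v =1 id
      & \prod_(x <- v) gen x = (\prod_(x <- u) gen x) ^ (gen y ^+ k)].
  by move/eqP: sz_v => sz_v; exists (Tuple sz_v).
elim: k => [|k [v [sz_v v1 ev]]]; first by exists u; rewrite expg0 conjg1.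
exists (tau_word y v); split; first by rewrite size_tau_word.
  move=> z; apply: (@perm_inj _ (sg y)).
  by have := sigma_word_braid v y z; rewrite !v1 => ->.
rewrite expgSr conjgM -ev /conjg; apply: (mulgI (gen y)).
by rewrite mulgA mulgV mul1g gen_word_braid v1.
Qed.

Section UniqueRoots.

Hypothesis expg_inj :
  forall n, 0 < n -> injective (fun a : structure_group s => a ^+ n).

Lemma commute_gen x y : commute (gen x) (gen y).
Proof.
pose n := #[sg x].
apply: (commute_of_expgl expg_inj (order_gt0 (sg x))).
have -> : gen x ^+ n = \prod_(z <- nseq n x) gen z.
  by rewrite big_nseq; elim: (n) => //= m <-; rewrite expgS.
have x1 : sigma_word (nseq n x) =1 id.
  by move=> z; rewrite sigma_word_nseq expg_order perm1.
apply: (commute_of_finite_conj expg_inj) => k.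
exact: gen_word_finite_conj y k x1.
Qed.

(** From generators to all elements: two morphisms, conjugation by a fixed
    element and the identity, are compared on generators, first for
    conjugation by a generator and then for conjugation by any element. *)
Lemma structure_group_comm (a b : structure_group s) : commute a b.
Proof.
have central (c : structure_group s) :
    (forall x, commute (gen x) c) -> forall d, commute d c.
  move=> gen_c d; apply/commgP/conjg_fixP.
  apply: (structure_morph_eq (f := conjg^~ c) (g := id)) => //.
    by move=> d1 d2; apply: conjMg.
  by move=> x; apply/conjg_fixP/commgP.
apply: (central) => x; apply/esym; apply: (central) => y; exact: commute_gen.
Qed.

End UniqueRoots.
End Braiding.

(** * Rack orbits and a cocycle separating them *)

Lemma orbit_sub_closed (X : finType) (A : {set {perm X}}) (B : {pred X}) x :
    (forall p y, p \in A -> y \in B -> p y \in B) -> x \in B ->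
  {subset orbit 'P <<A>>%g x <= B}.
Proof.
move=> AB Bx _ /orbitP[p Ap <-] /=; rewrite /aperm.
have /gen_prodgP[n [c Ac ->]] := Ap.
elim: n c Ac {Ap} => [|n IHn] c Ac; first by rewrite big_ord0 perm1.
by rewrite big_ord_recr /= permM AB // IHn.
Qed.

Section RackOrbits.
Variables (X : finType) (s : solution X).
Local Notation sg := (sigma s).
Local Notation ta := (tau s).
Local Notation gen := (structure_gen s).

Definition sol_group : {group {perm X}} :=
  <<[set sg z | z : X] :|: [set ta z | z : X]>>%G.
Definition rack_group : {group {perm X}} := <<[set rack_perm s y | y : X]>>%G.

(** Each tau_w is a rack automorphism, hence permutes the rack orbits; this is
    what makes twist below compatible with the relations of the group. *)
Lemma tau_rack_op w x y : ta w (rack_op s x y) = rack_op s (ta w x) (ta w y).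
Proof.
have [z ->] : exists z, y = ta x z by exists (((ta x)^-1)%g y); rewrite permKV.
have -> : rack_op s x (ta x z) = ta (ta x z) (sg z x) by rewrite /rack_op permK.
rewrite yb_tau yb_mixed /rack_op; congr (ta _ (sg _ _)).
by rewrite yb_tau permK.
Qed.

Lemma rack_op_tau x y : rack_op s y (ta y x) = ta (ta y x) (sg x y).
Proof. by rewrite /rack_op permK. Qed.

Lemma orbit_rack_op x y :
  orbit 'P rack_group (rack_op s x y) = orbit 'P rack_group x.
Proof.
have -> : rack_op s x y = 'P%act x (rack_perm s y) by rewrite /= /aperm permE.
by apply: orbit_act; apply/mem_gen/imset_f.
Qed.

Lemma tau_rack_orbit w x z :
  (ta w z \in orbit 'P rack_group (ta w x)) = (z \in orbit 'P rack_group x).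
Proof.
have closed y u v : u \in orbit 'P rack_group v ->
    rack_op s u y \in orbit 'P rack_group v.
  by rewrite -!orbit_eq_mem orbit_rack_op.
apply/idP/idP.
  pose B := [pred u | ((ta w)^-1)%g u \in orbit 'P rack_group x].
  move=> wz; suff : ta w z \in B by rewrite inE permK.
  apply: orbit_sub_closed wz; last by rewrite inE permK orbit_refl.
  move=> _ u /imsetP[y _ ->]; rewrite !inE [rack_perm s y u]permE.
  suff -> : ((ta w)^-1 (rack_op s u y) =
      rack_op s ((ta w)^-1 u) ((ta w)^-1 y))%g by apply: closed.
  by apply: (canLR (permK _)); rewrite tau_rack_op !permKV.
pose B := [pred u | ta w u \in orbit 'P rack_group (ta w x)].
move=> xz; suff : z \in B by rewrite inE.
apply: orbit_sub_closed xz; last by rewrite inE orbit_refl.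
move=> _ u /imsetP[y _ ->]; rewrite !inE [rack_perm s y u]permE.
by rewrite tau_rack_op => /closed.
Qed.

(** The affine transformation with linear part tau_x and translation part the
    indicator of the rack orbit of x, over the field with two elements: a finite
    stand-in for the cocycle with values in the free abelian group on the rack
    orbits. *)
Definition twist (x : X) (v : {ffun X -> bool}) : {ffun X -> bool} :=
  [ffun z => v (((ta x)^-1)%g z) (+) (z \in orbit 'P rack_group x)].

Lemma twist_inj x : injective (twist x).
Proof.
move=> v v' /ffunP e; apply/ffunP=> z.
by have := e (ta x z); rewrite !ffunE permK => /addIb.
Qed.

Lemma twist_braid x y v :
  twist y (twist x v) = twist (ta y x) (twist (sg x y) v).
Proof.
apply/ffunP=> z; rewrite !ffunE -!addbA; congr (_ (+) _).
  congr (v _); apply: (canLR (permK _)); apply: (canLR (permK _)).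
  by rewrite yb_tau !permKV.
rewrite addbC; congr (_ (+) _).
  rewrite -[RHS](tau_rack_orbit (ta y x)) permKV -rack_op_tau.
  by rewrite orbit_rack_op.
by rewrite -[LHS](tau_rack_orbit y) permKV.
Qed.

(** Applied to the zero function, the action of a generator returns the
    indicator of its rack orbit. *)
Lemma gen_eq_rack_orbit x y :
  gen x = gen y -> orbit 'P rack_group x = orbit 'P rack_group y.
Proof.
pose f x : {perm {ffun X -> bool}} := perm (@twist_inj x).
have [|h _ h_gen] := @structure_lift _ s _ f.
  by move=> u v; apply/permP=> w; rewrite !permM !permE twist_braid.
move=> /(congr1 (fun a => h a [ffun=> false])).
rewrite !h_gen !permE => /ffunP e; apply/setP=> z.
by have := e z; rewrite !ffunE.
Qed.

End RackOrbits.

(** * Generators are constant on orbits *)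

Section BiOrderableStructureGroup.
Variables (X : finType) (s : solution X).
Local Notation sg := (sigma s).
Local Notation ta := (tau s).
Local Notation gen := (structure_gen s).
Hypothesis bi_ord : bi_orderable (structure_group s).

Lemma bi_orderable_commute (a b : structure_group s) : commute a b.
Proof.
have [le [[refl anti trans tot] mono]] := bi_ord.
apply: structure_group_comm; exact: (expg_root_inj refl anti trans tot mono).
Qed.

(** Maximum principle: at a point t of the sigma-orbit of y where the generator
    is largest, its power is a product of generators from the same orbit, so all
    of them are equal to it; maximality thus spreads over the orbit. *)
Lemma gen_sigma x y : gen (sg x y) = gen y.
Proof.
have [le [[refl anti trans tot] mono]] := bi_ord.
pose S := <<[set sg z | z : X]>>%G.
have S_sigma z u : u \in orbit 'P S y -> sg z u \in orbit 'P S y.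
  by rewrite (orbit_actr 'P) //; apply/mem_gen/imset_f.
have [t St max_t] := max_over_finite refl trans tot
  (P := [in orbit 'P S y]) gen (orbit_refl 'P S y).
have gen_max u : gen u = gen t -> u \in orbit 'P S y ->
    forall z, gen (sg z u) = gen u.
  move=> gu Su z; pose m := #[ta u]%g.
  have m_gt0 : 0 < m by exact: order_gt0.
  (* The product over i < m has its factor sigma_z(u) at i = 0, the head of the
     tau_u-trajectory of z. *)
  apply: (prodg_eq_expg refl anti trans mono (F := fun z => gen (sg z u))
    (r := traject (ta u) (ta u z) m.-1)).
    by move=> w; rewrite gu; apply/max_t/S_sigma.
  rewrite -trajectS prednK // size_traject prednK //.
  have := gen_expg_braid s z u m; rewrite expg_order perm1.
  by rewrite [LHS]bi_orderable_commute => /mulIg.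
have gen_const u : u \in orbit 'P S y -> gen u = gen t.
  rewrite -(orbit_eqP St) => Su; apply/eqP.
  pose B := [pred u | (u \in orbit 'P S y) && (gen u == gen t)].
  suff /andP[] : u \in B by [].
  apply: orbit_sub_closed Su; last by rewrite inE St /=.
  move=> _ v /imsetP[z _ ->]; rewrite !inE => /andP[Sv /eqP gv].
  by rewrite S_sigma // gen_max // gv /=.
by rewrite gen_const ?S_sigma ?orbit_refl // -(gen_const y) ?orbit_refl.
Qed.

Lemma gen_tau x y : gen (ta y x) = gen x.
Proof.
have := structure_gen_rel s x y.
by rewrite [LHS]bi_orderable_commute gen_sigma => /mulgI.
Qed.

Lemma gen_sol_orbit x y : y \in orbit 'P (sol_group s) x -> gen y = gen x.
Proof.
move=> xy; apply/eqP; suff : y \in [pred z | gen z == gen x] by [].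
apply: orbit_sub_closed xy; last by rewrite inE.
move=> p u; rewrite !inE => /orP[] /imsetP[z _ ->] /eqP <-.
  by rewrite gen_sigma.
by rewrite gen_tau.
Qed.

Lemma sol_orbit_eq_rack_orbit x :
  orbit 'P (sol_group s) x = orbit 'P (rack_group s) x.
Proof.
apply/eqP; rewrite eqEsubset; apply/andP; split; apply/subsetP=> z xz.
  by apply/orbit_eqP/gen_eq_rack_orbit/gen_sol_orbit.
apply: orbit_sub_closed xz; last exact: orbit_refl.
move=> _ u /imsetP[y _ ->]; rewrite permE => xu.
rewrite (orbit_actr 'P); last by apply/mem_gen; rewrite inE imset_f ?orbT.
by rewrite (orbit_actr 'P) //; apply/mem_gen; rewrite inE imset_f.
Qed.

Lemma sol_orbits_eq_rack_orbits : sol_orbits s = rack_orbits s.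
Proof. by apply: eq_imset => x; apply: sol_orbit_eq_rack_orbit. Qed.

End BiOrderableStructureGroup.

(** * The isomorphism with the free abelian group on the orbits *)

(** An abelian group in additive notation, which gives access to integer
    multiples and finite sums; the commutativity proof is a parameter so that
    it can be recovered by instance resolution. *)
Definition comm_additive (G : groupType)
  (_ : forall a b : G, commute a b) : Type := G.

Section CommAdditive.
Variables (G : groupType) (G_comm : forall a b : G, commute a b).
Local Notation V := (comm_additive G_comm).
HB.instance Definition _ := Choice.on V.
HB.instance Definition _ := GRing.isZmodule.Build V
  (@mulgA G) G_comm (@mul1g G) (@mulVg G).
End CommAdditive.

Section OrbitCoordinates.
Variables (X : finType) (s : solution X).
Local Notation gen := (structure_gen s).
Local Notation k := (num_sol_orbits s).
Hypothesis bi_ord : bi_orderable (structure_group s).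
Variable O : 'I_k -> {set X}.
Hypothesis O_orbits : [set O i | i : 'I_k] = sol_orbits s.

(** An enumeration of k orbits by k indices has no repetition, so every point
    has a well-defined orbit index. *)
Lemma orbit_indexP : exists idx : X -> 'I_k,
  [/\ forall i x, x \in O i -> idx x = i,
      forall x y, y \in orbit 'P (sol_group s) x <-> idx y = idx x &
      forall i, exists x, idx x = i].
Proof.
have O_inj : injective O.
  have /imset_injP O_inj : #|O @: 'I_k| == #|'I_k|.
    by rewrite [O @: _]O_orbits card_ord.
  by move=> i j; apply: O_inj.
have O_orbit i x : x \in O i -> O i = orbit 'P (sol_group s) x.
  have /imsetP[y _ ->] : O i \in sol_orbits s by rewrite -O_orbits imset_f.
  by move/orbit_eqP.
have exO x : exists i, x \in O i.
  have : orbit 'P (sol_group s) x \in sol_orbits s by apply: imset_f.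
  by rewrite -O_orbits => /imsetP[i _ e]; exists i; rewrite -e orbit_refl.
pose idx x := xchoose (exO x).
have idxO x : x \in O (idx x) by apply: xchooseP (exO x).
have idxP i x : x \in O i -> idx x = i.
  by move=> /O_orbit e; apply: O_inj; rewrite e; apply/O_orbit/idxO.
exists idx; split=> // [x y|i].
  by rewrite -(O_orbit _ _ (idxO x)); split=> [/idxP | <-].
have /imsetP[x _ e] : O i \in sol_orbits s by rewrite -O_orbits imset_f.
by exists x; apply: idxP; rewrite e orbit_refl.
Qed.

(** The inverse mu sends an integer vector to the corresponding combination of
    generators, one for each orbit; it is a left inverse of nu because every
    generator equals the chosen one of its orbit. *)
Lemma orbit_coordinates :
  exists nu : {multiplicative structure_group s ->
                 Algebra.to_multiplicative 'rV[int]_k},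
    (forall (i : 'I_k) (x : X), x \in O i -> nu (gen x) = delta_mx ord0 i) /\
    bijective nu.
Proof.
have [idx [idxP idx_orbit idx_onto]] := orbit_indexP.
pose e x : Algebra.to_multiplicative 'rV[int]_k := delta_mx ord0 (idx x).
have [|nu nuM nu_gen] := @structure_lift _ s _ e.
  move=> x y; have -> : (e x * e y = e y * e x)%g := addrC _ _.
  congr (_ * _)%g; congr delta_mx.
    apply/esym/idx_orbit; rewrite (orbit_actr 'P) ?orbit_refl //.
    by apply/mem_gen; rewrite inE imset_f.
  apply/esym/idx_orbit; rewrite (orbit_actr 'P) ?orbit_refl //.
  by apply/mem_gen; rewrite inE imset_f ?orbT.
pose nu_m := isMultiplicative.Build _ _ nu nuM.
pose nu' : {multiplicative structure_group s ->
  Algebra.to_multiplicative 'rV[int]_k} := HB.pack nu nu_m.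
exists nu'; split=> [i x /idxP <-|]; first exact: nu_gen.
pose V := comm_additive (bi_orderable_commute bi_ord).
have [x_ x_idx] : exists x_ : 'I_k -> X, forall i, idx (x_ i) = i.
  have ex_idx i : exists x, idx x == i by have [x <-] := idx_onto i; exists x.
  by exists (fun i => xchoose (ex_idx i)) => i; apply/eqP/(xchooseP (ex_idx i)).
pose mu (v : 'rV[int]_k) : V := (\sum_i (gen (x_ i) : V) *~ v ord0 i)%R.
have muD : {morph mu : u v / (u + v)%R}.
  move=> u v; rewrite /mu -big_split /=; apply: eq_bigr => i _.
  by rewrite mxE mulrzDr.
have mu_delta i : mu (delta_mx ord0 i) = gen (x_ i).
  rewrite /mu (bigD1 i) //= [X in (_ + X)%R](big1 (idx := 0%R : V)).
    by rewrite addr0 mxE !eqxx.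
  by move=> j ne_ji; rewrite mxE eqxx /= (negPf ne_ji).
have nu1 : nu 1%g = 0%R.
  by apply: (@addrI 'rV[int]_k (nu 1%g)); rewrite -[LHS]nuM mulg1 addr0.
pose nu_add : {additive V -> 'rV[int]_k} :=
  HB.pack (nu : V -> 'rV[int]_k)
    (GRing.isNmodMorphism.Build V _ nu (nu1, nuM)).
exists mu => [a | v] /=.
  apply: (structure_morph_eq (f := mu \o nu) (g := id)) => // [b c|x] /=.
    by rewrite nuM [LHS]muD.
  rewrite nu_gen mu_delta.
  by apply/(gen_sol_orbit bi_ord)/idx_orbit.
rewrite -[nu _]/(nu_add (mu v)) raddf_sum [RHS]row_sum_delta.
apply: eq_bigr => i _.
rewrite raddfMz /= nu_gen /e x_idx.
by rewrite -scaler_int intz.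
Qed.
End OrbitCoordinates.

Lemma row_freeg_bij (k : nat) :
  exists f : {multiplicative Algebra.to_multiplicative 'rV[int]_k ->
                 Algebra.to_multiplicative {freeg 'I_k / int}}, bijective f.
Proof.
pose f (v : 'rV[int]_k) : {freeg 'I_k / int} := (\sum_i << v ord0 i *g i >>)%R.
have fD : {morph f : u v / (u + v)%R}.
  move=> u v; rewrite /f -big_split /=; apply: eq_bigr => i _.
  by rewrite mxE freegUD.
pose fm := isMultiplicative.Build (Algebra.to_multiplicative 'rV[int]_k)
  (Algebra.to_multiplicative {freeg 'I_k / int}) f fD.
exists (HB.pack_for {multiplicative _ -> _}
  (f : Algebra.to_multiplicative 'rV[int]_k ->
       Algebra.to_multiplicative {freeg 'I_k / int}) fm).
have coeff_f v i : coeff i (f v) = v ord0 i.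
  rewrite raddf_sum (bigD1 i) //= big1 => [|j ne_ji]; rewrite coeffU.
    by rewrite eqxx mulr1 addr0.
  by rewrite (negPf ne_ji) mulr0.
exists (fun w : {freeg 'I_k / int} => \row_i coeff i w)%R => [v|w] /=.
  by apply/rowP=> i; rewrite mxE coeff_f.
by apply/eqP/freeg_eqP => i; rewrite coeff_f mxE.
Qed.

Lemma bi_orderable_free_abelian (X : finType) (s : solution X) :
  bi_orderable (structure_group s) -> free_abelian (structure_group s).
Proof.
move=> bi_ord.
have O_orbits : [set enum_val i | i : 'I_(num_sol_orbits s)] = sol_orbits s.
  apply/setP=> B; apply/imsetP/idP => [[i _ ->]|sB]; first exact: enum_valP.
  by exists (enum_rank_in sB B); rewrite ?enum_rankK_in.
have [nu [_ nu_bij]] := orbit_coordinates bi_ord O_orbits.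
have [f f_bij] := row_freeg_bij (num_sol_orbits s).
pose g := f \o nu.
have gM : {morph g : a b / (a * b)%g} by move=> a b; rewrite /g /= !gmulfM.
exists 'I_(num_sol_orbits s).
exists (HB.pack_for {multiplicative _ -> _} g
  (isMultiplicative.Build _ _ g gM)).
exact: bij_comp.
Qed.

(** The basis I carries no order, but the images of the generators of the
    structure group involve only a finite list J of basis elements.  The
    coefficients along J determine an element, and comparing them
    lexicographically is invariant under translations. *)
Lemma free_abelian_bi_orderable (X : finType) (s : solution X) :
  free_abelian (structure_group s) -> bi_orderable (structure_group s).
Proof.
case=> I [f f_bij].
pose J := flatten [seq dom (f (structure_gen s x) : {freeg I / int}) | x : X].
pose c (a : structure_group s) : seqlexi int :=
  [seq coeff i (f a : {freeg I / int}) | i <- J].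
have fM a b : f (a * b)%g = (f a + f b : {freeg I / int})%R by exact: gmulfM.
have coeff_out i a : i \notin J -> coeff i (f a : {freeg I / int}) = 0%R.
  move=> nJi.
  pose h b : Algebra.to_multiplicative int := coeff i (f b : {freeg I / int}).
  rewrite -[LHS]/(h a) (structure_morph_eq (f := h) (g := fun=> 1%g)) //.
    by move=> b d; rewrite /h fM coeffD.
  move=> x; apply: coeff_outdom; apply: contra nJi => fxi.
  by apply/flatten_mapP; exists x; rewrite ?mem_enum.
have c_inj : injective c.
  move=> a b /eq_in_map e; apply: (bij_inj f_bij); apply/eqP/freeg_eqP => i.
  by case: (boolP (i \in J)) => [/e //|nJi]; rewrite !coeff_out.
pose le := [rel a b | (c a <= c b)%O]; exists le; split.
  split=> [a|a b /le_anti /c_inj //|a b d|a b] /=; first exact: lexx.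
    exact: le_trans.
  exact: le_total.
have le_mul a b d : le a b -> le (d * a)%g (d * b)%g.
  rewrite /le /= /c; elim: (J) => //= i r IHr.
  rewrite !lexi_cons !fM !coeffD !lerD2l => /andP[-> /implyP le_r] /=.
  by rewrite -!fM; apply/implyP => /le_r/IHr.
move=> a b d ab; split; first exact: le_mul.
have comm (u v : structure_group s) : (u * v = v * u)%g.
  by apply: (bij_inj f_bij); rewrite !fM addrC.
by rewrite !(comm _ d); apply: le_mul.
Qed.

Theorem theorem7p2 (X : finType) (s : solution X) :
  (bi_orderable (structure_group s) <-> free_abelian (structure_group s)) /\
  (bi_orderable (structure_group s) ->
     (sol_orbits s = rack_orbits s /\ num_sol_orbits s = num_rack_orbits s) /\
     (forall O : 'I_(num_sol_orbits s) -> {set X},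
        [set O i | i : 'I_(num_sol_orbits s)] = sol_orbits s ->
        exists nu : {multiplicative structure_group s ->
                       Algebra.to_multiplicative 'rV[int]_(num_sol_orbits s)},
          (forall (i : 'I_(num_sol_orbits s)) (x : X), x \in O i ->
             nu (structure_gen s x) = delta_mx ord0 i) /\
          bijective nu)).
Proof.
split.
  split; [exact: bi_orderable_free_abelian | exact: free_abelian_bi_orderable].
move=> bi_ord; split; last exact: orbit_coordinates.
have orbitsE := sol_orbits_eq_rack_orbits bi_ord.
by split=> //; rewrite /num_sol_orbits orbitsE.
Qed.
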